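(* Let $(X,d)$ be a metric space with $|X|\geqslant 3$, and let $T\colon X\to X$ be a generalized Kannan type mapping with a constant $\lambda$ satisfying $0\leqslant\lambda<\frac25$. Then $T$ is a generalized Chatterjea type mapping with respect to the metric $d$.
   Context: Let $(X,d)$ be a metric space with $|X|\geqslant 3$. A mapping $T\colon X\to X$ is a generalized Kannan type mapping with constant $\lambda\in[0,\frac23)$ if $$d(Tx,Ty)+d(Ty,Tz)+d(Tx,Tz)\leqslant\lambda\,(d(x,Tx)+d(y,Ty)+d(z,Tz))$$ holds for all three pairwise distinct points $x,y,z\in X$. A mapping $T\colon X\to X$ is a generalized Chatterjea type mapping on $X$ if there exists $\gamma\in[0,\frac13)$ such that $$d(Tx,Ty)+d(Ty,Tz)+d(Tx,Tz)\leqslant \gamma\,(d(x,Ty)+d(x,Tz)+d(y,Tx)+d(y,Tz)+d(z,Tx)+d(z,Ty))$$ holds for all three pairwise distinct points $x,y,z\in X$. *)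

(* Defs.v *)
From mathcomp Require Import all_boot all_order all_algebra.
From mathcomp Require Import all_classical all_reals all_analysis.

Set Implicit Arguments.
Unset Strict Implicit.
Unset Printing Implicit Defensive.

Import Order.TTheory GRing.Theory Num.Theory.

Local Open Scope ring_scope.

Definition generalized_kannan (R : realType) (X : metricType R) (T : X -> X)
    (lambda : R) : Prop :=
  0 <= lambda < 2 / 3 /\
  forall x y z : X, x <> y -> y <> z -> x <> z ->
    mdist (T x) (T y) + mdist (T y) (T z) + mdist (T x) (T z) <=
    lambda * (mdist x (T x) + mdist y (T y) + mdist z (T z)).

Definition generalized_chatterjea (R : realType) (X : metricType R)
    (T : X -> X) : Prop :=
  exists gamma : R, 0 <= gamma < 1 / 3 /\
  forall x y z : X, x <> y -> y <> z -> x <> z ->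
    mdist (T x) (T y) + mdist (T y) (T z) + mdist (T x) (T z) <=
    gamma * (mdist x (T y) + mdist x (T z) + mdist y (T x) + mdist y (T z)
             + mdist z (T x) + mdist z (T y)).

(* Main.v *)
(** Averaging d(x,Tx) <= d(x,Ty) + d(Tx,Ty) and d(x,Tx) <= d(x,Tz) + d(Tx,Tz),
    and summing over the three points, bounds the Kannan sum K in terms of the
    Chatterjea sum C and the perimeter S of Tx, Ty, Tz: 2K <= C + 2S.  Hence
    S <= lambda K gives S <= lambda / (2(1 - lambda)) C, and this constant is
    below 1/3 exactly when lambda < 2/5. *)
Require Import Defs.
From mathcomp Require Import all_boot all_order all_algebra.
From mathcomp Require Import all_classical all_reals all_analysis.
From mathcomp Require Import lra.

Set Implicit Arguments.
Unset Strict Implicit.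
Unset Printing Implicit Defensive.

Import Order.TTheory GRing.Theory Num.Theory.

Local Open Scope classical_set_scope.
Local Open Scope card_scope.
Local Open Scope ring_scope.

Lemma kannan_sum_le (R : realType) (X : metricType R) (T : X -> X) (x y z : X) :
  2 * (mdist x (T x) + mdist y (T y) + mdist z (T z)) <=
  mdist x (T y) + mdist x (T z) + mdist y (T x) + mdist y (T z)
    + mdist z (T x) + mdist z (T y)
    + 2 * (mdist (T x) (T y) + mdist (T y) (T z) + mdist (T x) (T z)).
Proof.
have tri a b : mdist a (T a) <= mdist a (T b) + mdist (T a) (T b).
  by rewrite (metric_sym (T a)) metric_triangle.
have := (tri x y, tri x z, tri y x, tri y z, tri z x, tri z y).
(* The six instances of [tri] contain each side of the image triangle in both orientations.
   Orienting them alike leaves three atoms, each occurring twice, which gives the factor 2 for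
   [lra]. *)
rewrite (metric_sym (T y) (T x)) (metric_sym (T z) (T x)) (metric_sym (T z) (T y)).
by case=> [[[[[? ?] ?] ?] ?] ?]; lra.
Qed.

Theorem proposition2p5 (R : realType) (X : metricType R)
  (cardX : `I_3 #<= [set: X]) (T : X -> X) (lambda : R)
  (lambda_bounds : 0 <= lambda < 2 / 5)
  (kannanT : generalized_kannan T lambda) :
  generalized_chatterjea T.
Proof.
have /andP[l0 l25] := lambda_bounds.
have [_ kannan] := kannanT.
have d0 : 0 < 2 * (1 - lambda) by lra.
exists (lambda / (2 * (1 - lambda))); split.
  by rewrite divr_ge0 ?(ltW d0) //= ltr_pdivrMr //; lra.
move=> x y z xy yz xz.
rewrite mulrAC ler_pdivlMr //.
have K := kannan x y z xy yz xz.
(* With S, K, C the perimeter, Kannan and Chatterjea sums, this reads 2 [lambda] K <= [lambda] C + 2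
   [lambda] S. Adding twice [K] leaves 2 (1 - [lambda]) S <= [lambda] C, linear once the products of
   [lambda] with distances are atoms. *)
have := ler_wpM2l l0 (kannan_sum_le T x y z).
lra.
Qed.
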